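(* Let $\Delta$ be a simplicial complex on the vertex set $[n]$ with facets $F_1,\ldots,F_r$, and let $\Gamma\subset\mathbb{N}_\infty^n$ be the multicomplex with facets $a_{F_1},\ldots,a_{F_r}$. Then $F_1,\ldots,F_r$ is a shelling of $\Delta$ if and only if $a_{F_1},\ldots,a_{F_r}$ is a shelling of $\Gamma$.
   Context: For $F\subset[n]$, $a_F\in\mathbb{N}_\infty^n$ is defined by $a_F(i)=\infty$ if $i\in F$ and $a_F(i)=0$ if $i\notin F$. Shelling of $\Delta$ (non-pure in general): an order $F_1,\dots,F_r$ of all facets such that for $i=2,\dots,r$ all facets of $\langle F_1,\dots,F_{i-1}\rangle\cap\langle F_i\rangle$ are maximal proper faces of $\langle F_i\rangle$ (i.e. of the form $F_i\setminus\{v\}$), where $\langle G_1,\dots,G_k\rangle$ denotes the smallest subcomplex containing $G_1,\dots,G_k$. $\mathbb{N}=\{0,1,2,\dots\}$, $\mathbb{N}_\infty=\mathbb{N}\cup\{\infty\}$, and $\mathbb{N}_\infty^n$ is ordered componentwise. A subset $\Gamma\subset\mathbb{N}_\infty^n$ is a multicomplex if (1) $a\in\Gamma$, $b\in\mathbb{N}_\infty^n$, $b\le a$ imply $b\in\Gamma$; and (2) $\Gamma$ contains the (componentwise) limit of every ascending sequence $a_1\le a_2\le\cdots$ of elements of $\Gamma$. $\Gamma(a_1,\dots,a_k)=\{b\in \mathbb{N}_\infty^n: b\le a_i\text{ for some }i\}$ is the smallest multicomplex containing $a_1,\dots,a_k$ (empty if $k=0$). For $a\in\mathbb{N}_\infty^n$,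 $\operatorname{infpt}a=\{i:a(i)=\infty\}$; $a\in\Gamma$ is a facet of $\Gamma$ if $\operatorname{infpt}a=\operatorname{infpt}m$ for all maximal elements $m$ of $\Gamma$ with $a\le m$. The multicomplex of the claim is $\Gamma=\Gamma(a_{F_1},\dots,a_{F_r})$. A Stanley set is a subset of the form $T=a+T^*$ with $a\in\mathbb{N}^n$ and $T^*=\Gamma(m)$ for some $m\in\mathbb{N}_\infty^n$ with all $m(i)\in\{0,\infty\}$. A shelling of a multicomplex $\Gamma$ is an order $a_1,\dots,a_r$ of its facets such that (1) $S_i=\Gamma(a_i)\setminus\Gamma(a_1,\dots,a_{i-1})$ is a Stanley set for $i=1,\dots,r$; and (2) whenever $S_i^*\subset S_j^*$, then $S_i^*=S_j^*$ or $i>j$. *)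

(* Defs.v *)
From mathcomp Require Import all_boot.
From mathcomp Require Import boolp classical_sets.

Set Implicit Arguments.
Unset Strict Implicit.
Unset Printing Implicit Defensive.

(* [s] lists the elements satisfying [P], each exactly once *)
Definition is_order_of (T : eqType) (P : T -> Prop) (s : seq T) : Prop :=
  uniq s /\ forall x, x \in s <-> P x.

Section SimplicialComplexes.
Variable n : nat.
Local Open Scope set_scope.

(* [n] is modelled by 'I_n. The singletons are not required to be faces. *)
Definition simplicial_complex (Delta : {set {set 'I_n}}) : bool :=
  [forall F in Delta, forall G : {set 'I_n}, (G \subset F) ==> (G \in Delta)].

Definition face_facet (Delta : {set {set 'I_n}}) (F : {set 'I_n}) : bool :=
  maxset (fun G : {set 'I_n} => G \in Delta) F.

Definition subcomplex_gen (s : seq {set 'I_n}) : {set {set 'I_n}} :=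
  \bigcap_(D : {set {set 'I_n}}
    | simplicial_complex D && ([set F in s] \subset D)) D.

(* Indices start at 0, so the condition for i = 2, ..., r becomes 0 < i < r. *)
Definition simplicial_shelling (Delta : {set {set 'I_n}})
    (s : seq {set 'I_n}) : Prop :=
  is_order_of (face_facet Delta) s /\
  forall i, 0 < i < size s -> forall G,
    face_facet (subcomplex_gen (take i s) :&:
                subcomplex_gen [:: nth finset.set0 s i])
      G ->
    exists2 v, v \in nth finset.set0 s i & G = nth finset.set0 s i :\ v.

End SimplicialComplexes.

(* N together with infinity: [Some k] is the number k, [None] is infinity *)
Definition natinf := option nat.

Definition leinf (x y : natinf) : bool :=
  match x, y with
  | _, None => true
  | None, Some _ => false
  | Some j, Some k => j <= k
  end.

Definition addinf (x y : natinf) : natinf :=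
  match x, y with
  | Some j, Some k => Some (j + k)
  | _, _ => None
  end.

(* convergence in the one-point compactification of the discrete space N *)
Definition cvg_natinf (u : nat -> natinf) (l : natinf) : Prop :=
  match l with
  | Some k => exists N, forall p, N <= p -> u p = Some k
  | None => forall M, exists N, forall p, N <= p -> leinf (Some M) (u p)
  end.

Section Multicomplexes.
Variable n : nat.

Definition vecinf := {ffun 'I_n -> natinf}.

Definition levec (a b : vecinf) : bool := [forall i, leinf (a i) (b i)].

Definition addvec (a b : vecinf) : vecinf := [ffun i => addinf (a i) (b i)].

Definition infpt (a : vecinf) : {set 'I_n} := [set i | a i == None]%SET.

Local Open Scope classical_set_scope.

Record multicomplex := Multicomplex {
  mc_set :> set vecinf;
  mc_lower : forall a b, mc_set a -> levec b a -> mc_set b;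
  mc_limit : forall (u : nat -> vecinf) (l : vecinf),
    (forall p, mc_set (u p)) -> (forall p, levec (u p) (u p.+1)) ->
    (forall i, cvg_natinf (fun p => u p i) (l i)) -> mc_set l }.

Definition mcgen_set (s : seq vecinf) : set vecinf :=
  [set b | exists2 a, a \in s & levec b a].

Lemma leinf_trans : transitive leinf.
Proof.
by case=> [y|] [x|] [z|] //=; apply: leq_trans.
Qed.

Lemma levec_trans : transitive levec.
Proof.
move=> b a c /forallP ab /forallP bc; apply/forallP => i.
exact: leinf_trans (ab i) (bc i).
Qed.

Lemma cvg_natinf_gt (u : nat -> natinf) (l x : natinf) :
  cvg_natinf u l -> ~~ leinf l x -> exists N, forall p, N <= p -> ~~ leinf (u p) x.
Proof.
case: l => [k|] /=; first by move=> [N uN] lx; exists N => p /uN ->.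
case: x => // j uoo _; have [N uN] := uoo j.+1; exists N => p /uN.
by case: (u p) => //= m; rewrite ltnNge.
Qed.

Lemma mcgen_lower (s : seq vecinf) (a b : vecinf) :
  mcgen_set s a -> levec b a -> mcgen_set s b.
Proof. by move=> [c cs ac] ba; exists c => //; apply: levec_trans ba ac. Qed.

Lemma mcgen_limit (s : seq vecinf) (u : nat -> vecinf) (l : vecinf) :
  (forall p, mcgen_set s (u p)) -> (forall p, levec (u p) (u p.+1)) ->
  (forall i, cvg_natinf (fun p => u p i) (l i)) -> mcgen_set s l.
Proof.
move=> us _ ul; have [/hasP//|/hasPn nl] := boolP (has (levec l) s).
have [N uN] : exists N, forall p, N <= p ->
    forall a, a \in s -> ~~ levec (u p) a.
  elim: s nl {us} => [|a s IHs] nl; first by exists 0.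
  have [|N uN] := IHs; first by move=> b bs; apply: nl; rewrite inE bs orbT.
  have /nl : a \in a :: s by rewrite mem_head.
  rewrite negb_forall => /existsP[i /(cvg_natinf_gt (ul i))[M uM]].
  exists (maxn M N) => p; rewrite geq_max => /andP[Mp Np] b.
  rewrite inE => /predU1P[->|]; last exact: uN.
  by apply/negP => /forallP /(_ i); apply/negP/uM.
by have [a as_ uNa] := us N; have := uN N (leqnn N) a as_; rewrite uNa.
Qed.

Definition mcgen (s : seq vecinf) : multicomplex :=
  Multicomplex (@mcgen_lower s) (@mcgen_limit s).

Definition mc_maximal (Gamma : multicomplex) (m : vecinf) : Prop :=
  mc_set Gamma m /\ forall b, mc_set Gamma b -> levec m b -> b = m.

(* A facet need not be a maximal element: it only has to have the same infinite
   part as every maximal element above it. *)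
Definition mc_facet (Gamma : multicomplex) (a : vecinf) : Prop :=
  mc_set Gamma a /\ forall m, mc_maximal Gamma m -> levec a m -> infpt a = infpt m.

(* T = a + Tstar is a Stanley set. T determines Tstar, so quantifying over
   Tstar is the same as speaking of T^*. *)
Definition stanley_set_with (T Tstar : set vecinf) : Prop :=
  exists (a : {ffun 'I_n -> nat}) (m : vecinf),
    [/\ forall i, m i = Some 0 \/ m i = None,
        Tstar = mcgen [:: m] &
        T = [set addvec [ffun i => Some (a i)] c | c in Tstar]].

Definition shelling_step (s : seq vecinf) (i : nat) : set vecinf :=
  mcgen [:: nth [ffun=> Some 0] s i] `\` mcgen (take i s).

Definition mc_shelling (Gamma : multicomplex) (s : seq vecinf) : Prop :=
  [/\ is_order_of (mc_facet Gamma) s,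
      forall i, i < size s ->
        exists Tstar, stanley_set_with (shelling_step s i) Tstar &
      forall i j (Ti Tj : set vecinf), i < size s -> j < size s ->
        stanley_set_with (shelling_step s i) Ti ->
        stanley_set_with (shelling_step s j) Tj ->
        Ti `<=` Tj -> Ti = Tj \/ j < i].

Definition vec_of_face (F : {set 'I_n}) : vecinf :=
  [ffun i => if i \in F then None else Some 0].

End Multicomplexes.

(* Main.v *)
(** Membership of [b] in [Gamma(a_F)] depends only on the support of [b], so
    the step [S_i] consists of the vectors whose support lies in [F_i] but in
    no earlier facet.  It is a Stanley set if and only if, for some subset [R]
    of [F_i], these supports are exactly the sets between [R] and [F_i] ([R] is
    the support of the base point).  This says that the faces of [F_i] already
    covered are those missing an element of [R], i.e. that they are generated by
    the sets [F_i :\ v] with [v] in [R], which is the simplicial condition.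
    Moreover [S_i^*] is then [Gamma(a_(F_i))], and facets are pairwise
    incomparable, so the second axiom of a multicomplex shelling is automatic. *)

Require Import Defs.
From mathcomp Require Import boolp classical_sets.
From mathcomp Require Import all_boot.

Set Implicit Arguments.
Unset Strict Implicit.
Unset Printing Implicit Defensive.

Section ShellingComparison.
Variable n : nat.
Implicit Types (G H R : {set 'I_n}) (s : seq {set 'I_n}) (a b c m : vecinf n).

Local Notation covered s G := (has (fun H => G \subset H) s).

(** * Generated subcomplexes *)

Lemma face_subset (D : {set {set 'I_n}}) G H :
  simplicial_complex D -> H \in D -> G \subset H -> G \in D.
Proof.
by move=> /forallP/(_ H)/implyP cD /cD/forallP/(_ G)/implyP; apply.
Qed.

Lemma mem_subcomplex_gen s G : (G \in subcomplex_gen s) = covered s G.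
Proof.
apply/idP/idP => [|/hasP[H sH GH]]; last first.
  apply/bigcapP => D /andP[cD /subsetP sD].
  by apply: face_subset cD _ GH; apply: sD; rewrite inE.
(* The subsets of members of [s] form one of the complexes being intersected. *)
move/bigcapP => /(_ [set K : {set 'I_n} | covered s K]%SET).
rewrite inE; apply; apply/andP; split.
  apply/forallP => H; apply/implyP; rewrite inE => /hasP[K sK HK].
  apply/forallP => L; apply/implyP => LH.
  by rewrite inE; apply/hasP; exists K => //; apply: subset_trans HK.
by apply/subsetP => H; rewrite !inE => sH; apply/hasP; exists H.
Qed.

(** * Supports and infinite parts of vectors *)

Definition vec_support b : {set 'I_n} := [set i | b i != Some 0]%SET.

Lemma vec_support_face G : vec_support (vec_of_face G) = G.
Proof. by apply/setP => i; rewrite !inE ffunE; case: (i \in G). Qed.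

Lemma levec_face b G : levec b (vec_of_face G) = (vec_support b \subset G).
Proof.
apply/forallP/subsetP => [bG i|bG i]; last first.
  have := bG i; rewrite inE ffunE; case: (i \in G); first by case: (b i).
  by case: (b i) => [[|k]|] //= /(_ isT).
by have := bG i; rewrite inE ffunE; case: (i \in G) => //; case: (b i) => [[|k]|].
Qed.

Lemma vec_of_face_inj : injective (@vec_of_face n).
Proof. by move=> G H GH; rewrite -(vec_support_face G) GH vec_support_face. Qed.

Lemma infpt_face G : infpt (vec_of_face G) = G.
Proof. by apply/setP => i; rewrite inE ffunE; case: (i \in G). Qed.

Lemma levec_refl a : levec a a.
Proof. by apply/forallP => i; case: (a i) => /=. Qed.

Lemma infpt_support b : infpt b \subset vec_support b.
Proof. by apply/subsetP => i; rewrite !inE => /eqP->. Qed.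

(** Coordinates in [G] are infinite and those outside vanish, so no finite positive value
    remains. *)
Lemma infpt_support_face b G :
  infpt b = G -> vec_support b \subset G -> b = vec_of_face G.
Proof.
move=> bG /subsetP sG; apply/ffunP => i; rewrite ffunE -{1}bG inE.
have := sG i; rewrite inE -bG inE.
by case: (b i) => [[|k]|] //= /(_ isT).
Qed.

Lemma mem_mcgen_faces s b :
  mcgen_set [seq vec_of_face G | G <- s] b <-> covered s (vec_support b).
Proof.
split=> [[_ /mapP[G sG ->]]|/hasP[G sG bG]].
  by rewrite levec_face => bG; apply/hasP; exists G.
by exists (vec_of_face G); rewrite ?levec_face // map_f.
Qed.

Lemma mem_mcgen1 a b : mcgen_set [:: a] b <-> levec b a.
Proof.
by split=> [[c /[!inE] /eqP->]|ba] //; exists a; rewrite ?inE.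
Qed.

Lemma mem_shelling_step s i b : i < size s ->
  shelling_step [seq vec_of_face G | G <- s] i b <->
  vec_support b \subset nth finset.set0 s i /\
  ~~ covered (take i s) (vec_support b).
Proof.
move=> ltis; rewrite /shelling_step (nth_map finset.set0) // -map_take.
split=> [[/mem_mcgen1 ba nb]|[bF nb]].
  split; first by rewrite -levec_face.
  by apply/negP => /mem_mcgen_faces.
split; first by apply/mem_mcgen1; rewrite levec_face.
by move=> /mem_mcgen_faces; rewrite (negPf nb).
Qed.

(** * Translates and Stanley steps *)

Definition zero_vec : vecinf n := [ffun=> Some 0].

Lemma zero_vec_le a : levec zero_vec a.
Proof. by apply/forallP => i; rewrite ffunE; case: (a i). Qed.

Lemma addvec0 a : addvec a zero_vec = a.
Proof. by apply/ffunP => i; rewrite !ffunE; case: (a i) => //= k; rewrite addn0. Qed.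

Lemma support_addvecl a c : vec_support a \subset vec_support (addvec a c).
Proof.
apply/subsetP => i; rewrite !inE ffunE.
by case: (a i) => [[|k]|]; case: (c i).
Qed.

Lemma support_addvecr a c : vec_support c \subset vec_support (addvec a c).
Proof.
apply/subsetP => i; rewrite !inE ffunE.
by case: (a i) => [k|]; case: (c i) => [[|j]|] //; rewrite /= addnS.
Qed.

Lemma infpt_addvec_nat (a : {ffun 'I_n -> nat}) c :
  infpt (addvec [ffun i => Some (a i)] c) = infpt c.
Proof. by apply/setP => i; rewrite !inE !ffunE; case: (c i). Qed.

Lemma stanley_set_base (T Tstar : set (vecinf n)) (a : {ffun 'I_n -> nat}) m :
  Tstar = mcgen [:: m] ->
  T = [set addvec [ffun i => Some (a i)] c | c in Tstar]%classic ->
  T [ffun i => Some (a i)].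
Proof.
move=> -> ->; exists zero_vec; last exact: addvec0.
by apply/mem_mcgen1; apply: zero_vec_le.
Qed.

(** In shelling theory [R] is the restriction of the facet: the unique minimal face that it adds. *)
Definition restriction_set s i R : Prop :=
  R \subset nth finset.set0 s i /\
  forall G, G \subset nth finset.set0 s i ->
    covered (take i s) G = ~~ (R \subset G).

Lemma stanley_step_restriction s i : i < size s ->
  (exists Tstar,
     stanley_set_with (shelling_step [seq vec_of_face G | G <- s] i) Tstar) <->
  exists R, restriction_set s i R.
Proof.
move=> ltis; split=> [[Tstar [a [m [m01 TsE TE]]]]|[R [RF resR]]].
  pose av : vecinf n := [ffun i => Some (a i)].
  have /(mem_shelling_step _ ltis)[aF na] := stanley_set_base TsE TE.
  exists (vec_support av); split=> // G GF; have [aG|aG] /= := boolP (_ \subset G).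
    (* An earlier facet containing [G] would contain the support of the base point, which lies in
       the step. *)
    apply: contraNF na => /hasP[H sH GH]; apply/hasP; exists H => //.
    exact: subset_trans GH.
  apply: contraNT aG => nG.
  (* An uncovered [G] puts [vec_of_face G] in the step; it is then the base point plus some [c], and
     adding [c] cannot shrink the support. *)
  have : shelling_step [seq vec_of_face G | G <- s] i (vec_of_face G).
    by apply/(mem_shelling_step _ ltis); rewrite vec_support_face.
  by rewrite TE => -[c _ cG]; rewrite -(vec_support_face G) -cG support_addvecl.
exists (mcgen [:: vec_of_face (nth finset.set0 s i)]).
(* The least base point with support [R] is its indicator vector. *)
exists [ffun x => nat_of_bool (x \in R)], (vec_of_face (nth finset.set0 s i)).
split=> //; first by move=> x; rewrite ffunE; case: ifP; [right|left].
apply/predeqP => b; split=> [/(mem_shelling_step _ ltis)[bF]|].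
  rewrite resR // negbK => /subsetP Rb.
  (* Truncated subtraction is harmless here: [b] is nonzero on [R]. *)
  exists [ffun x => if b x is Some k then Some (k - (x \in R)) else None].
    apply/mem_mcgen1; rewrite levec_face; apply: subset_trans bF.
    by apply/subsetP => x; rewrite !inE ffunE; case: (b x) => [[|k]|].
  apply/ffunP => x; rewrite !ffunE; have := Rb x; rewrite inE.
  case: (b x) => [k|] //= Rx; congr Some; rewrite subnKC //.
  by case: (x \in R) Rx => // /(_ isT); case: k.
case=> c /mem_mcgen1; rewrite levec_face => cF <-.
apply/(mem_shelling_step _ ltis).
set d := addvec _ _.
have dF : vec_support d \subset nth finset.set0 s i.
  apply/subsetP => x; have := subsetP cF x; have := subsetP RF x.
  by rewrite !inE !ffunE; case: (x \in R) => [-> //|_]; case: (c x) => [[|k]|].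
split=> //; rewrite resR // negbK; apply/subsetP => x xR.
by rewrite !inE !ffunE xR; case: (c x).
Qed.

(** The base point plus [m] lies in the step, which bounds the support of [m] by the facet. The
    vector of the facet is also in the step, and a finite base point contributes no infinite
    coordinate, so [m] is infinite on the whole facet. *)
Lemma stanley_step_star s i (Tstar : set (vecinf n)) : i < size s ->
  ~~ covered (take i s) (nth finset.set0 s i) ->
  stanley_set_with (shelling_step [seq vec_of_face G | G <- s] i) Tstar ->
  Tstar = mcgen [:: vec_of_face (nth finset.set0 s i)].
Proof.
set F := nth _ _ _ => ltis nF [a [m [m01 TsE TE]]].
rewrite TsE; congr (mc_set (mcgen [:: _])).
have mF : vec_support m \subset F.
  have : shelling_step [seq vec_of_face G | G <- s] i
      (addvec [ffun i => Some (a i)] m).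
    by rewrite TE TsE; exists m => //; apply/mem_mcgen1/levec_refl.
  case/(mem_shelling_step _ ltis) => aF _; apply: subset_trans aF.
  exact: support_addvecr.
apply: infpt_support_face => //; apply/eqP; rewrite eqEsubset.
rewrite (subset_trans (infpt_support m) mF) /=.
have : shelling_step [seq vec_of_face G | G <- s] i (vec_of_face F).
  by apply/(mem_shelling_step _ ltis); rewrite vec_support_face.
rewrite TE TsE => -[c /mem_mcgen1/forallP cm cF].
rewrite -(infpt_face F) -cF infpt_addvec_nat.
by apply/subsetP => x; rewrite !inE => /eqP cx; have := cm x; rewrite cx; case: (m x).
Qed.

(** * Simplicial steps *)

Lemma mem_step_complex s i G :
  (G \in subcomplex_gen (take i s) :&:
         subcomplex_gen [:: nth finset.set0 s i]) =
  covered (take i s) G && (G \subset nth finset.set0 s i).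
Proof. by rewrite inE !mem_subcomplex_gen /= orbF. Qed.

Lemma simplicial_step_restriction s i : 0 < i < size s ->
  (forall G,
    face_facet (subcomplex_gen (take i s) :&:
                subcomplex_gen [:: nth finset.set0 s i]) G ->
    exists2 v, v \in nth finset.set0 s i & G = nth finset.set0 s i :\ v) <->
  exists R, restriction_set s i R.
Proof.
move=> lt0is; have [_ ltis] := andP lt0is; set F := nth _ s i.
have sub_covered G H : G \subset H -> covered (take i s) H -> covered (take i s) G.
  by move=> GH /hasP[K sK HK]; apply/hasP; exists K => //; apply: subset_trans HK.
split=> [shF|[R [RF resR]] G /maxsetP[]].
  (* This choice is forced: for [G = F :\ v] the required equality says that [F :\ v] is covered
     exactly when [v] is in [R]. *)
  exists [set v in F | covered (take i s) (F :\ v)]%SET; split.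
    by apply/subsetP => v; rewrite inE => /andP[].
  move=> G GF; apply/idP/subsetPn => [cG|[v]].
    (* A maximal covered face [M] of [F] above [G] is some [F :\ v]; this [v] lies in the chosen set
       and outside [G]. *)
    have [|M maxM GM] := @maxset_exists _
      (fun H => H \in subcomplex_gen (take i s) :&: subcomplex_gen [:: F]) G.
      by rewrite mem_step_complex cG.
    have [v Fv ME] := shF _ maxM.
    exists v; last by apply: contraTN GM => Gv; apply/subsetPn; exists v;
      rewrite // ME !inE eqxx.
    have := maxsetp maxM; rewrite mem_step_complex ME => /andP[cM _].
    by rewrite inE Fv.
  rewrite inE => /andP[_ cv] vG; apply: sub_covered cv.
  by rewrite subsetD1 GF.
rewrite mem_step_complex => /andP[cG GF] maxG.
move: cG; rewrite resR // => /subsetPn[v Rv vG].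
have Fv := subsetP RF _ Rv.
(* [F :\ v] contains [G] and is covered, since it misses [v] in [R]; maximality of [G] gives
   equality. *)
exists v => //; apply/esym/maxG; last by rewrite subsetD1 GF.
rewrite mem_step_complex subD1set andbT resR ?subD1set //.
by apply/subsetPn; exists v; rewrite // !inE eqxx.
Qed.

(** Handles the first facet, on which the simplicial condition is silent: even the empty face is
    new. *)
Lemma restriction_set0 s : restriction_set s 0 finset.set0.
Proof. by split=> [|G _]; rewrite ?sub0set // take0. Qed.

(** * Incomparable facets and the facets of the multicomplex *)

Definition antichain s : Prop :=
  forall G H, G \in s -> H \in s -> G \subset H -> G = H.

Lemma face_facets_antichain (D : {set {set 'I_n}}) s :
  is_order_of (face_facet D) s -> antichain s.
Proof.
move=> [_ sD] G H /sD/maxsetP[_ maxG] /sD/maxsetp HD GH.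
by rewrite (maxG H HD GH).
Qed.

Lemma nth_not_covered s i : uniq s -> antichain s -> i < size s ->
  ~~ covered (take i s) (nth finset.set0 s i).
Proof.
move=> us acs ltis; apply/hasPn => H Hs; apply/negP => FH.
have sH := mem_take Hs.
have FE := acs _ _ (mem_nth finset.set0 ltis) sH FH.
have := index_ltn Hs.
by rewrite -FE index_uniq // ltnn.
Qed.

(** For [b] above the vector of [G] and below that of [H], the chain of [G], [infpt b],
    [vec_support b], [H] collapses because [G = H]. *)
Lemma mc_maximal_faces s G : antichain s -> G \in s ->
  mc_maximal (mcgen [seq vec_of_face H | H <- s]) (vec_of_face G).
Proof.
move=> acs sG; split.
  by apply/mem_mcgen_faces; rewrite vec_support_face; apply/hasP; exists G.
move=> b /mem_mcgen_faces/hasP[H sH bH] /forallP Gb.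
have Gib : G \subset infpt b.
  apply/subsetP => i iG; rewrite inE; have := Gb i.
  by rewrite ffunE iG; case: (b i).
have GE : G = H.
  apply: acs => //; apply: subset_trans bH.
  exact: subset_trans (infpt_support b).
rewrite -GE in bH; apply: infpt_support_face => //; apply/eqP.
by rewrite eqEsubset Gib andbT (subset_trans (infpt_support b)).
Qed.

(** A facet lies below some maximal [vec_of_face G], hence has infinite part [G] and support inside
    [G]. *)
Lemma mc_facets_faces s : uniq s -> antichain s ->
  is_order_of (mc_facet (mcgen [seq vec_of_face H | H <- s]))
    [seq vec_of_face H | H <- s].
Proof.
move=> us acs; split; first by rewrite map_inj_uniq //; apply: vec_of_face_inj.
move=> a; split=> [/mapP[G sG ->]|[/mem_mcgen_faces/hasP[G sG aG] maxa]].
  have [Gs maxG] := mc_maximal_faces acs sG.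
  by split=> // m [ms _] /(maxG _ ms)->.
apply/mapP; exists G => //; apply: infpt_support_face => //.
rewrite -[RHS](infpt_face G); apply: maxa; first exact: mc_maximal_faces.
by rewrite levec_face.
Qed.

End ShellingComparison.

Theorem proposition10p3 (n : nat) (Delta : {set {set 'I_n}})
    (F : seq {set 'I_n})
    (Delta_complex : simplicial_complex Delta)
    (F_facets : is_order_of (face_facet Delta) F) :
  simplicial_shelling Delta F <->
  mc_shelling (mcgen [seq vec_of_face G | G <- F]) [seq vec_of_face G | G <- F].
Proof.
have uF := F_facets.1; have acF := face_facets_antichain F_facets.
split=> [[_ shF]|[_ stF _]]; last first.
  split=> // i lt0iF; have [_ ltiF] := andP lt0iF.
  apply/(simplicial_step_restriction lt0iF)/(stanley_step_restriction ltiF).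
  by apply: stF; rewrite size_map.
split; first exact: mc_facets_faces.
  move=> i; rewrite size_map => ltiF; apply/(stanley_step_restriction ltiF).
  case: i ltiF => [|i] ltiF.
    by exists finset.set0; apply: restriction_set0.
  by apply/simplicial_step_restriction => //; apply: shF.
move=> i j Ti Tj; rewrite !size_map => ltiF ltjF.
move=> /(stanley_step_star ltiF (nth_not_covered uF acF ltiF)) ->.
move=> /(stanley_step_star ltjF (nth_not_covered uF acF ltjF)) -> sTij; left.
set Fi := nth _ F i; set Fj := nth _ F j; suff -> : Fi = Fj by [].
apply: acF; rewrite ?mem_nth //.
(* The top vector of the smaller star lies in the larger one, which means that [Fi] is contained in
   [Fj]. *)
have /sTij/mem_mcgen1 : mcgen_set [:: vec_of_face Fi] (vec_of_face Fi).
  by apply/mem_mcgen1/levec_refl.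
by rewrite levec_face vec_support_face.
Qed.
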